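(* Let $P=\frac12P_1+\frac12P_2$, where $P_1$ is the uniform distribution on $L_1=\{(t,0):-1\le t\le1\}$ and $P_2$ is the uniform distribution on $L_2=\{(\cos t,\sin t):0\le t\le\pi\}$. Then the set $\left\{\left(-\frac14-\frac1\pi,\frac1\pi\right),\left(\frac14+\frac1\pi,\frac1\pi\right)\right\}$ forms the optimal set of two-means for $P$, and the quantization error for two-means is $$V_2=2\left(\frac{96-24\pi+7\pi^2}{192\pi^2}+\frac{-96-8\pi+17\pi^2}{64\pi^2}\right)\approx0.242369.$$
   Context: For a Borel probability measure $P$ on $\mathbb{R}^2$ with finite second moment, the $n$th quantization error is $V_n=V_n(P)=\inf\{\int\min_{a\in\alpha}\|x-a\|^2\,dP(x):\alpha\subset\mathbb{R}^2,\ \mathrm{card}(\alpha)\le n\}$; a set with at most $n$ points attaining the infimum is an optimal set of $n$-means. The measure $P$ has density (with respect to arc length) $\frac14$ on $L_1$ and $\frac1{2\pi}$ on $L_2$. *)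

(* Defs.v *)
From HB Require Import structures.
From mathcomp Require Export all_boot all_order all_algebra.
From mathcomp Require Export all_classical all_reals all_analysis.
From mathcomp Require Export measurable_realfun.
Set Implicit Arguments.
Unset Strict Implicit.
Unset Printing Implicit Defensive.
Import Order.TTheory GRing.Theory Num.Theory.
Import numFieldNormedType.Exports.
Local Open Scope classical_set_scope.
Local Open Scope ring_scope.

(* R^2 with the product of the two Borel sigma-algebras, that is, its Borel
   sigma-algebra. *)
Definition plane (R : realType) := (measurableTypeR R * measurableTypeR R)%type.

(* The norm that the library puts on a product is the max norm, so the
   Euclidean squared distance is written out. *)
Definition sqdist (R : realType) (x a : plane R) : R :=
  (x.1 - a.1) ^+ 2 + (x.2 - a.2) ^+ 2.

(* The infimum is a minimum when A is finite and nonempty; it is +oo when A is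
   empty. *)
Definition min_sqdist (R : realType) (A : set (plane R)) (x : plane R) : \bar R :=
  ereal_inf [set (sqdist x a)%:E | a in A].

Definition distortion (R : realType) (P : probability (plane R) R)
    (A : set (plane R)) : \bar R :=
  (\int[P]_x min_sqdist A x)%E.

Definition quantization_error (R : realType) (P : probability (plane R) R)
    (n : nat) : \bar R :=
  ereal_inf [set distortion P A | A in [set A : set (plane R) | (A #<= `I_n)%card]].

Definition optimal_set_of_means (R : realType) (P : probability (plane R) R)
    (n : nat) (A : set (plane R)) : Prop :=
  (A #<= `I_n)%card /\ distortion P A = quantization_error P n.

Section mixture.
Context d (T : measurableType d) (R : realType).
Variables P1 P2 : probability T R.

Let half : {nonneg R} := (2^-1)%:nng.

Definition half_mixture : set T -> \bar R :=
  measure_add (mscale half P1) (mscale half P2).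

HB.instance Definition _ := Measure.on half_mixture.

Lemma half_mixtureE A :
  half_mixture A = ((2^-1)%:E * P1 A + (2^-1)%:E * P2 A)%E.
Proof. by rewrite /half_mixture measure_addE. Qed.

Let half_mixture_setT : half_mixture [set: T] = 1%:E.
Proof.
rewrite half_mixtureE.
rewrite [P1 _](probability_setT P1) [P2 _](probability_setT P2).
by rewrite !mule1 -EFinD -div1r -splitr.
Qed.

HB.instance Definition _ :=
  Measure_isProbability.Build _ _ _ half_mixture half_mixture_setT.

End mixture.

Section uniform_curves.
Variable R : realType.

Definition segment_param (t : measurableTypeR R) : plane R := (t, 0).

Definition arc_param (t : measurableTypeR R) : plane R := (cos t, sin t).

Lemma measurable_segment_param : measurable_fun setT segment_param.
Proof. by apply: measurable_fun_pair. Qed.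

Lemma measurable_arc_param : measurable_fun setT arc_param.
Proof.
apply: measurable_fun_pair.
- by apply: continuous_measurable_fun; exact: continuous_cos.
- by apply: continuous_measurable_fun; exact: continuous_sin.
Qed.

HB.instance Definition _ :=
  isMeasurableFun.Build _ _ _ _ segment_param measurable_segment_param.
HB.instance Definition _ :=
  isMeasurableFun.Build _ _ _ _ arc_param measurable_arc_param.

Lemma ltrN11 : (- 1 : R) < 1.
Proof. exact: gtrN. Qed.

(* Both parametrizations have unit speed, so the image of the uniform law on
   the parameter interval is the normalized arc length measure on the curve. *)
Definition uniform_segment : probability (plane R) R :=
  distribution (uniform_prob ltrN11) segment_param.

Definition uniform_arc : probability (plane R) R :=
  distribution (uniform_prob (pi_gt0 R)) arc_param.

Definition segment_arc_law : probability (plane R) R :=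
  half_mixture uniform_segment uniform_arc.

End uniform_curves.

(* Main.v *)
Require Import Defs.
From mathcomp Require Import ring lra.
Set Implicit Arguments.
Unset Strict Implicit.
Unset Printing Implicit Defensive.
Import Order.TTheory GRing.Theory Num.Theory.
Import numFieldNormedType.Exports.
Local Open Scope classical_set_scope.
Local Open Scope ring_scope.

(* For the pair c +- r e with e = (cos th, sin th) and s = <c, e>,
     min(|x - a|^2, |x - b|^2) = |x - c|^2 + r^2 - 2 r |<x, e> - s|.
   Completing the square in r, the distortion of a pair is at least V2 as soon as
     F^2 <= K^2 + (s - E<X, e>)^2,  F = E|<X, e> - s|,  K = 1/4 + 1/pi,
   and K is the value of F at th = s = 0, the only case of equality.
   If the bisector <x, e> = s separates the common endpoints (-1, 0), (1, 0) of the
   two curves, F is explicit and at most K + s^2/2 - th s/pi. Otherwise the bisector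
   cuts off at most a cap of the arc, and F^2 - (s - E<X, e>)^2 <= 1/pi < K^2, the
   last step being (1/pi - 1/4)^2 > 0. *)

(** * Numerical bounds on pi *)

(** By the mean value theorem. The Taylor bounds and the trigonometric inequalities below are drawn
    from it. *)
Lemma le_of_is_derive (R : realType) (f df : R -> R) (a b : R) : a <= b ->
  (forall x : R, is_derive x (1 : R) f (df x)) ->
  (forall x, a <= x <= b -> 0 <= df x) -> f a <= f b.
Proof.
move=> ab fE df0.
have [|c] := @MVT_segment R f df a b ab (fun x _ => fE x).
  apply: continuous_subspaceT => x.
  exact/differentiable_continuous/derivable1_diffP/ex_derive.
rewrite in_itv/= => cab fab.
by rewrite -subr_ge0 fab mulr_ge0 ?subr_ge0 ?df0.
Qed.

(** * Alternating Taylor bounds for cosine and sine *)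

Section taylor_trigo.
Variable R : realType.

(** A Taylor polynomial at 0 in which [n] counts terms rather than degree, so that differentiation
    alternates between this family and [sin_poly]. *)
Definition cos_poly n : {poly R} :=
  \sum_(k < n) ((- 1) ^+ k / (k.*2)`!%:R) *: 'X^(k.*2).

Definition sin_poly n : {poly R} :=
  \sum_(k < n) ((- 1) ^+ k / (k.*2.+1)`!%:R) *: 'X^(k.*2.+1).

Lemma deriv_sin_poly n : (sin_poly n)^`() = cos_poly n.
Proof.
rewrite /sin_poly /cos_poly raddf_sum/=; apply: eq_bigr => k _.
rewrite derivZ derivXn/= -['X^_ *+ _]scaler_nat scalerA; congr (_ *: _).
rewrite factS natrM invfM -!mulrA; congr (_ * _).
by rewrite mulrCA mulVf ?mulr1// pnatr_eq0.
Qed.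

Lemma deriv_cos_poly n : (cos_poly n.+1)^`() = - sin_poly n.
Proof.
rewrite /sin_poly /cos_poly raddf_sum/= big_ord_recl/= expr0 derivZ derivXn.
rewrite mulr0n scaler0 add0r -sumrN; apply: eq_bigr => k _.
rewrite derivZ derivXn/= -['X^_ *+ _]scaler_nat scalerA -scaleNr; congr (_ *: _).
rewrite /bump/= add1n exprS mulN1r doubleS factS natrM invfM !mulNr; congr (- _).
rewrite -!mulrA; congr (_ * _).
by rewrite mulrCA mulVf ?mulr1// pnatr_eq0.
Qed.

Lemma cos_poly0 n : (cos_poly n.+1).[0] = 1.
Proof.
rewrite /cos_poly big_ord_recl hornerD expr0 fact0 divr1 scale1r expr0 hornerC.
rewrite horner_sum big1 ?addr0// => k _.
by rewrite hornerZ hornerXn lift0 doubleS expr0n/= mulr0.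
Qed.

Lemma sin_poly0 n : (sin_poly n).[0] = 0.
Proof.
by rewrite horner_sum big1// => k _; rewrite hornerZ hornerXn expr0n/= mulr0.
Qed.

(* The factorial is kept abstract because unary 14`! does not fit in memory. *)
Lemma horner_cos_poly : exists g : nat -> R,
  [/\ g 0 = 1, forall m, g m.+1 = m.+1%:R * g m &
    forall n x, (cos_poly n).[x] =
      \sum_(0 <= k < n) (- 1) ^+ k / g k.*2 * x ^+ k.*2].
Proof.
exists (fun m => m`!%:R); split => [//|m|n x]; first by rewrite factS natrM.
by rewrite horner_sum big_mkord; apply: eq_bigr => k _; rewrite hornerZ hornerXn.
Qed.

(* Each remainder is, up to sign, the derivative of the next one. *)
Lemma cos_sin_poly_alternate n (x : R) : 0 <= x ->
  0 <= (- 1) ^+ n.+1 * (cos x - (cos_poly n.+1).[x]) /\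
  0 <= (- 1) ^+ n.+1 * (sin x - (sin_poly n.+1).[x]).
Proof.
pose S n (y : R) : R := (- 1) ^+ n * (sin y - (sin_poly n).[y]).
pose C n (y : R) : R := (- 1) ^+ n * (cos y - (cos_poly n).[y]).
have dS m (y : R) : is_derive y (1 : R) (S m) (C m y).
  rewrite (_ : S m = ((- 1) ^+ m) \*: (@sin R - horner (sin_poly m)))//.
  by apply: is_derive_eq; rewrite deriv_sin_poly.
have dC m (y : R) : is_derive y (1 : R) (C m.+1) (S m y).
  rewrite (_ : C m.+1 = ((- 1) ^+ m.+1) \*: (@cos R - horner (cos_poly m.+1)))//.
  apply: is_derive_eq; rewrite deriv_cos_poly /S hornerN.
  by rewrite exprS /GRing.scale/=; ring.
have S0 m : S m 0 = 0 by rewrite /S sin0 sin_poly0 subrr mulr0.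
have C0 m : C m.+1 0 = 0 by rewrite /C cos0 cos_poly0 subrr mulr0.
elim: n x => [|n IH] x x0.
  have C1 y : 0 <= C 1 y.
    rewrite /C /cos_poly big_ord1 expr0 fact0 divr1 scale1r expr0 hornerC.
    by rewrite expr1 mulN1r oppr_ge0 subr_le0 cos_le1.
  split; first exact: C1.
  by rewrite -[leLHS](S0 1%N); apply: le_of_is_derive (dS 1%N) _.
have CP y : 0 <= y -> 0 <= C n.+2 y.
  move=> y0; rewrite -[leLHS](C0 n.+1).
  by apply: le_of_is_derive (dC n.+1) _ => // z /andP[z0 _]; case: (IH z z0).
split; first exact: CP.
rewrite -[leLHS](S0 n.+2).
by apply: le_of_is_derive (dS n.+2) _ => // z /andP[z0 _]; exact: CP.
Qed.

(** Let [y] be half of a claimed bound. If the bound failed, the position of [y] relative to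
    [pi / 2] would give [cos y] a sign. A Taylor polynomial with 8 terms from below, or 7 terms from
    above, gives the opposite strict sign by rational arithmetic. *)
Lemma pi_bounds :
  (3141 * 10 ^+ 3 + 592) / 10 ^+ 6 < pi :> R /\
  pi < (3141 * 10 ^+ 3 + 593) / 10 ^+ 6 :> R.
Proof.
have [p1 p2] := (@pihalf_ge1 R, @pihalf_lt2 R).
have [g [g0 gS gE]] := horner_cos_poly.
split.
- rewrite ltNge; apply/negP => h.
  pose y : R := (1570 * 10 ^+ 3 + 796) / 10 ^+ 6.
  have y0 : 0 <= y by rewrite /y; lra.
  have [+ _] := @cos_sin_poly_alternate 7 y y0.
  have : cos y <= 0.
    rewrite -[y](subrK (pi / 2)) cosDpihalf oppr_le0.
    by apply: sin_ge0_pi; rewrite /y; lra.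
  rewrite gE !(big_nat_recr _ _ _ (leq0n _)) (big_geq (leqnn 0)) !doubleS double0 !gS g0.
  by rewrite /y /=; lra.
- rewrite ltNge; apply/negP => h.
  pose y : R := (1570 * 10 ^+ 4 + 7965) / 10 ^+ 7.
  have y0 : 0 <= y by rewrite /y; lra.
  have [+ _] := @cos_sin_poly_alternate 6 y y0.
  have : 0 <= cos y by apply: cos_ge0_pihalf; rewrite /y; lra.
  rewrite gE !(big_nat_recr _ _ _ (leq0n _)) (big_geq (leqnn 0)) !doubleS double0 !gS g0.
  by rewrite /y /=; lra.
Qed.

End taylor_trigo.

(** * Inequalities *)

Section trigo_ineq.
Variable R : realType.
Implicit Types b t s th : R.

Lemma sin_le b : 0 <= b -> sin b <= b.
Proof.
move=> b0; rewrite -subr_ge0.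
have d x : is_derive x (1 : R) (id - @sin R) (1 - cos x).
  exact: is_deriveB.
have := le_of_is_derive b0 d; rewrite !fctE/= sin0 subr0; apply=> x _.
by rewrite subr_ge0 cos_le1.
Qed.

Lemma ler_cos : {in `[0, pi] &, {mono @cos R : x y /~ y <= x}}.
Proof. by move=> x y xI yI; rewrite !leNgt ltr_cos. Qed.

(** The function [sin x - x * cos x] vanishes at 0 and has derivative [x * sin x]. *)
Lemma mul_cos_le_sin b : 0 <= b <= pi -> b * cos b <= sin b.
Proof.
move=> /andP[b0 bpi]; rewrite -subr_ge0.
have d x : is_derive x (1 : R) (@sin R - id * @cos R) (x * sin x).
  by apply: is_derive_eq; rewrite /GRing.scale/=; ring.
have := le_of_is_derive b0 d; rewrite !fctE/= sin0 mul0r subrr; apply=> x /andP[x0 xb].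
by rewrite mulr_ge0// sin_ge0_pi// x0 (le_trans xb).
Qed.

(** Jordan's inequality. The difference [pi / 2 * sin x - x] vanishes at 0 and at [pi / 2]; it
    increases up to [acos (2 / pi)], where its derivative changes sign, and decreases afterwards. *)
Lemma le_pihalf_sin b : 0 <= b <= pi / 2 -> b <= pi / 2 * sin b.
Proof.
move=> /andP[b0 b1]; have p0 := pi_gt0 R; have p2 := pi_ge2 R.
rewrite -subr_ge0.
pose f : R -> R := (pi / 2) \*: @sin R - id.
have d x : is_derive x (1 : R) f (pi / 2 * cos x - 1).
  by rewrite /f; exact: is_derive_eq.
have dN x : is_derive x (1 : R) (- f) (1 - pi / 2 * cos x).
  by apply: is_derive_eq; rewrite opprB.
have cP : -1 <= 2 / (pi : R) <= 1.
  apply/andP; split; last by rewrite ler_pdivrMr// mul1r.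
  by rewrite (le_trans (lerN10 R))// divr_ge0// ltW.
pose c : R := acos (2 / pi).
have c0 : 0 <= c by exact: acos_ge0.
have cpi : c <= pi by exact: acos_lepi.
have pN0 : (pi : R) != 0 by rewrite gt_eqF.
have cc : pi / 2 * cos c = 1.
  rewrite acosK; last by rewrite in_itv/= cP.
  by rewrite mulrC mulrA divfK// divff// pnatr_eq0.
have fE x : f x = pi / 2 * sin x - x by [].
have fNE x : (- f) x = - f x by [].
have [bc|cb] := leP b c.
  have : f 0 <= f b.
    apply: le_of_is_derive b0 d _ => x /andP[x0 xb].
    rewrite subr_ge0 -[leLHS]cc ler_wpM2l ?divr_ge0 ?(ltW p0)//.
    by rewrite ler_cos ?in_itv/= ?c0 ?x0//; lra.
  by rewrite !fE sin0 mulr0 subr0.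
have : (- f) b <= (- f) (pi / 2).
  apply: le_of_is_derive b1 dN _ => x /andP[xb x1].
  rewrite subr_ge0 -[leRHS]cc ler_wpM2l ?divr_ge0 ?(ltW p0)//.
  by rewrite ler_cos ?in_itv/= ?c0//; lra.
by rewrite !fNE !fE sin_pihalf mulr1 subrr oppr0 oppr_le0.
Qed.

(** Both sides are even and agree at 0. Their difference has derivative
    [cos x * (pi / 2 * sin x - x)], non-negative by Jordan's inequality. With [s = sin b] this makes
    the arc contribution quadratic in [s]. *)
Lemma cosD_mul_sin_le b : - (pi / 2) <= b <= pi / 2 ->
  cos b + b * sin b <= 1 + pi / 4 * sin b ^+ 2.
Proof.
wlog b0 : b / 0 <= b => [H|/andP[_ b1]].
  have [/H//|/ltW b0 bp] := leP 0 b.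
  have := H (- b); rewrite cosN sinN mulrNN sqrrN; apply; first by rewrite oppr_ge0.
  by rewrite lerNl opprK lerNl andbC.
rewrite -subr_ge0.
pose f : R -> R := (pi / 4) \*: (@sin R * @sin R) - (@cos R + id * @sin R).
have d x : is_derive x (1 : R) f (cos x * (pi / 2 * sin x - x)).
  have ds := @is_derive_sin R x; have dc := @is_derive_cos R x.
  have di := @is_derive_id R R x 1.
  refine (is_derive_eq (is_deriveB (is_deriveZ _ (is_deriveM ds ds))
    (is_deriveD dc (is_deriveM di ds))) _).
  by rewrite /GRing.scale/=; move: (pi : R) => c; field.
have fE x : f x = pi / 4 * (sin x * sin x) - (cos x + x * sin x) by [].
have : f 0 <= f b.
  apply: le_of_is_derive b0 d _ => x /andP[x0 xb].
  have p0 := pi_gt0 R.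
  rewrite mulr_ge0// ?subr_ge0 ?le_pihalf_sin ?x0 ?(le_trans xb)//.
  by apply: cos_ge0_pihalf; lra.
by rewrite !fE sin0 cos0 !mulr0 addr0 sub0r; lra.
Qed.

End trigo_ineq.

(** * Polynomial inequalities in s, sin th and p = 1/pi *)

Section polynomial_inequalities.
Variable R : realType.
Implicit Types p s S F : R.

(** The enclosure of [pi] between 72/23 and 22/7 already leaves enough room in the inequalities
    below. *)
Lemma pi_inv_bounds : 7 / 22 < pi^-1 :> R /\ pi^-1 < 23 / 72 :> R.
Proof.
have [pi1 pi2] := pi_bounds R.
have p0 := pi_gt0 R.
have pV : pi^-1 * pi = 1 :> R by rewrite mulVf// gt_eqF.
split.
- by rewrite -[ltLHS]invf_div ltf_pV2 ?posrE ?divr_gt0//; lra.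
- by rewrite -[ltRHS]invf_div ltf_pV2 ?posrE ?divr_gt0//; lra.
Qed.

(** The case where [th] and [s] have the same sign, [S] being [|sin th|] and [K + w] a majorant of
    the deviation. The gap is an explicit sum of three non-negative terms. If it vanishes, the first
    term forces [s = 0], and then [S = 0]. *)
Lemma crossing_ineq_same p s S : 4^-1 < p -> p < 2^-1 -> 0 <= s <= 1 -> 0 <= S ->
  let w := s ^+ 2 / 2 - p * S * s in let K := 4^-1 + p in
  2 * K * w + w ^+ 2 <= (s - p * S) ^+ 2 /\
  (2 * K * w + w ^+ 2 = (s - p * S) ^+ 2 -> s = 0 /\ S = 0).
Proof.
move=> p1 p2 /andP[s0 s1] S0 w K.
have E : (s - p * S) ^+ 2 - (2 * K * w + w ^+ 2) =
    (2^-1 - p) * s ^+ 2 + 2 * p * (p - 4^-1) * (s * S) +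
    (1 - s) * (1 + s) * (s / 2 - p * S) ^+ 2.
  by rewrite /w /K; field.
have T1 : 0 <= (2^-1 - p) * s ^+ 2 by rewrite mulr_ge0 ?sqr_ge0//; lra.
have T2 : 0 <= 2 * p * (p - 4^-1) * (s * S).
  by rewrite !mulr_ge0//; lra.
have T3 : 0 <= (1 - s) * (1 + s) * (s / 2 - p * S) ^+ 2.
  by apply: mulr_ge0 (sqr_ge0 _); apply: mulr_ge0; lra.
split; first by lra.
move=> eq0.
have s00 : s = 0.
  have /eqP : (2^-1 - p) * s ^+ 2 = 0 by lra.
  by rewrite mulf_eq0 sqrf_eq0 => /orP[/eqP|/eqP//]; lra.
split=> //; have : (p * S) ^+ 2 = 0.
  by move: eq0; rewrite /w s00; lra.
by move/eqP; rewrite sqrf_eq0 mulf_eq0 => /orP[/eqP|/eqP//]; lra.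
Qed.

(** The case of opposite signs, with [S = |sin th|]. Jordan's inequality bounds [p * |th|] by
    [S / 2], hence the coefficient of [S * s] in [w]. *)
Lemma crossing_ineq_opp p s S : 7 / 22 < p -> p < 23 / 72 -> 0 <= s ->
  0 <= S -> s ^+ 2 + S ^+ 2 <= 1 ->
  let w := s ^+ 2 / 2 + S * s / 2 in let K := 4^-1 + p in
  2 * K * w + w ^+ 2 <= (s + p * S) ^+ 2 /\
  (2 * K * w + w ^+ 2 = (s + p * S) ^+ 2 -> s = 0 /\ S = 0).
Proof.
move=> p1 p2 s0 S0 sS w K.
have sS0 : 0 <= s * S by rewrite mulr_ge0.
have p2_ge : 10 / 99 <= p ^+ 2 by rewrite expr2; nra.
have s2_ge0 := sqr_ge0 s; have S2_ge0 := sqr_ge0 S.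
have T1 : 0 <= s ^+ 2 * (1 - s ^+ 2 - S ^+ 2).
  by apply: mulr_ge0 s2_ge0 _; lra.
have T2 : 0 <= (p - 7 / 22) * (s * S) by apply: mulr_ge0 _ sS0; lra.
have T3 : 0 <= (23 / 72 - p) * s ^+ 2 by apply: mulr_ge0 _ s2_ge0; lra.
have T4 : 0 <= (p ^+ 2 - 10 / 99) * S ^+ 2 by apply: mulr_ge0 _ S2_ge0; lra.
have E : (s + p * S) ^+ 2 - (2 * K * w + w ^+ 2) =
    (2^-1 - p) * s ^+ 2 + (p - 4^-1) * (s * S) + p ^+ 2 * S ^+ 2
    - s ^+ 2 * (s * S) / 2 + s ^+ 2 * (1 - s ^+ 2 - S ^+ 2) / 4.
  by rewrite /w /K; field.
(* The coefficients 9/50, 17/250 and 1/10 lie strictly below [1/2 - p], [p - 1/4] and [p^2]; the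
   slack in the two squares settles the equality case. *)
suff T : s ^+ 2 * (s * S) / 2 <= 9 / 50 * s ^+ 2 + 17 / 250 * (s * S) + S ^+ 2 / 10.
  split; first by lra.
  move=> eq0.
  have s00 : s ^+ 2 = 0 by lra.
  have S00 : S ^+ 2 = 0 by lra.
  by move/eqP: s00; move/eqP: S00; rewrite !sqrf_eq0 => /eqP-> /eqP->.
(* Since [s^2 + S^2 <= 1], the quadratic form may be multiplied by [s^2 + S^2]. What remains is a
   homogeneous quartic, namely [Q2] plus positive multiples of [Q3] and [Q4]. *)
have Q1 : 0 <= (9 / 50 * s ^+ 2 + 17 / 250 * (s * S) + S ^+ 2 / 10) *
    (1 - s ^+ 2 - S ^+ 2).
  by clear E; apply: mulr_ge0; lra.
have Q2 : 0 <= s ^+ 2 * (9 / 50 * s ^+ 2 - 54 / 125 * (s * S) + 7 / 25 * S ^+ 2).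
  apply: mulr_ge0 s2_ge0 _.
  have -> : 9 / 50 * s ^+ 2 - 54 / 125 * (s * S) + 7 / 25 * S ^+ 2 =
    9 / 50 * (s - 6 / 5 * S) ^+ 2 + 13 / 625 * S ^+ 2 by field.
  by apply: addr_ge0; apply: mulr_ge0; rewrite ?sqr_ge0 ?divr_ge0 ?ler0n.
have Q3 : 0 <= (s * S) * S ^+ 2 by exact: mulr_ge0.
have Q4 : 0 <= S ^+ 2 * S ^+ 2 by exact: mulr_ge0.
by lra.
Qed.

(** The symmetry [(th, s) -> (- th, - s)] reduces to [0 <= s]. Then [th] is replaced by its sine,
    through [sin th <= th] if [th] is non-negative and through Jordan's inequality otherwise. *)
Lemma main_crossing_bound th s F : - (pi / 2) <= th <= pi / 2 ->
  s ^+ 2 + sin th ^+ 2 <= 1 -> 0 <= F ->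
  F <= 4^-1 + pi^-1 + s ^+ 2 / 2 - pi^-1 * th * s ->
  F ^+ 2 <= (4^-1 + pi^-1) ^+ 2 + (s - pi^-1 * sin th) ^+ 2 /\
  (F ^+ 2 = (4^-1 + pi^-1) ^+ 2 + (s - pi^-1 * sin th) ^+ 2 ->
   s = 0 /\ sin th = 0).
Proof.
wlog s0 : th s / 0 <= s => [H|].
  have [s0|/ltW s0] := leP 0 s; first exact: H.
  move=> thI sS F0 Fle; have := H (- th) (- s).
  have E1 : (- s - pi^-1 * - sin th) ^+ 2 = (s - pi^-1 * sin th) ^+ 2.
    by rewrite -sqrrN opprB mulrN opprK addrC.
  have E2 : pi^-1 * - th * - s = pi^-1 * th * s by rewrite !mulrN mulNr opprK.
  rewrite sinN E1 E2 !sqrrN oppr_ge0 lerN2 lerNl andbC => /(_ s0 thI sS F0 Fle).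
  move=> [-> E]; split=> // /E[/eqP + /eqP].
  by rewrite !oppr_eq0 => /eqP -> /eqP ->.
have p0 := pi_gt0 R.
have pV : pi^-1 * pi = 1 :> R by rewrite mulVf// gt_eqF.
have [q1 q2] := pi_inv_bounds.
set p := pi^-1 in pV q1 q2 *.
move=> /andP[th1 th2] sS F0 Fle.
have s1 : s <= 1.
  by rewrite -(@ler_pXn2r _ 2)// ?nnegrE// expr1n; have := sqr_ge0 (sin th); lra.
have [th0|/ltW th0] := leP 0 th.
  have S0 : 0 <= sin th by apply: sin_ge0_pi; lra.
  have [||||I E] := @crossing_ineq_same p s (sin th); [lra|lra|by rewrite s0|by []|].
  set w := s ^+ 2 / 2 - p * sin th * s in I E.
  have Fw : F <= 4^-1 + p + w.
    have : 0 <= p * s * (th - sin th) by rewrite !mulr_ge0// ?subr_ge0 ?sin_le//; lra.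
    by rewrite /w; lra.
  have F2 : F ^+ 2 <= (4^-1 + p + w) ^+ 2 by rewrite ler_pXn2r ?nnegrE//; lra.
  by split; [lra|move=> FE; apply: E; lra].
have S0 : 0 <= - sin th by rewrite -sinN; apply: sin_ge0_pi; lra.
have [|||||I E] := @crossing_ineq_opp p s (- sin th);
  [by []|by []|by []|by []|by rewrite sqrrN|].
set w := s ^+ 2 / 2 + - sin th * s / 2 in I E.
have Fw : F <= 4^-1 + p + w.
  have : - th <= pi / 2 * sin (- th) by apply: le_pihalf_sin; lra.
  rewrite sinN => thS.
  have : 0 <= p * s * (pi / 2 * - sin th - - th) by rewrite !mulr_ge0 ?subr_ge0//; lra.
  have sE : p * s * (pi / 2 * - sin th) = p * pi * (- sin th * s / 2) by ring.
  rewrite mulrBr sE.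
  by rewrite pV /w; lra.
have F2 : F ^+ 2 <= (4^-1 + p + w) ^+ 2 by rewrite ler_pXn2r ?nnegrE//; lra.
rewrite mulrN in I E.
split; first by lra.
move=> FE; have [|? /eqP] := E; first by lra.
by rewrite oppr_eq0 => /eqP.
Qed.

(* The left side minus the last square is at most [4 p sin al cos al (1 - cos al)
   <= p], where [p = 1/pi]. *)
Lemma noncrossing_bound (al S : R) : 0 <= al <= pi / 2 -> sin al <= S -> S <= 1 ->
  (cos al - pi^-1 * S + 2 * pi^-1 * (sin al - al * cos al)) ^+ 2 <
  (4^-1 + pi^-1) ^+ 2 + (cos al - pi^-1 * S) ^+ 2.
Proof.
move=> /andP[al0 al1] SS S1.
have p0 := pi_gt0 R.
have pV : pi^-1 * pi = 1 :> R by rewrite mulVf// gt_eqF.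
have [q1 q2] := pi_inv_bounds.
set p := pi^-1 in pV q1 q2 *.
set f := sin al - al * cos al.
have c0 : 0 <= cos al by apply: cos_ge0_pihalf; lra.
have c1 := cos_le1 al.
have s0 : 0 <= sin al by apply: sin_ge0_pi; lra.
have sal := sin_le al0.
have f1 : f <= sin al * (1 - cos al) by rewrite /f; nra.
have f2 : f <= sin al by rewrite /f; nra.
have f0 : 0 <= f by rewrite subr_ge0 mul_cos_le_sin// al0; lra.
(* The left square exceeds [(cos al - p S)^2] by [4 p f cos al - 4 p^2 f (S - f)], and
   [f <= sin al <= S] gives the subtracted term its sign. *)
have I1 : 0 <= p * f * (S - f) by rewrite !mulr_ge0//; lra.
have I2 : f * cos al <= sin al * (1 - cos al) * cos al by rewrite ler_wpM2r.
have I3 : sin al * (1 - cos al) * cos al <= 4^-1.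
  have : 0 <= (1 - sin al) * ((1 - cos al) * cos al) by rewrite !mulr_ge0// subr_ge0 ?sin_le1.
  have := sqr_ge0 (cos al - 2^-1); rewrite expr2; lra.
have I4 : p * (f * cos al) <= p * 4^-1 by rewrite ler_pM2l; lra.
have I5 : 0 <= p * (p * f * (S - f)) by rewrite mulr_ge0//; lra.
have : 0 < (p - 4^-1) ^+ 2 by rewrite exprn_gt0//; lra.
by lra.
Qed.

End polynomial_inequalities.

(** * Mean absolute deviation along a direction *)

Section integrals.
Variable R : realType.
Notation mu := (@lebesgue_measure R).
Implicit Types (f g G : R -> R) (a b c C s t th al x : R).

Lemma is_derive_continuous f df : (forall x : R, is_derive x (1 : R) f (df x)) ->
  continuous f.
Proof.
by move=> fE x; exact/differentiable_continuous/derivable1_diffP/ex_derive.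
Qed.

Lemma continuous_integrable_itv f a b : continuous f ->
  mu.-integrable `[a, b] (EFin \o f).
Proof.
move=> cf; apply: continuous_compact_integrable; first exact: segment_compact.
exact: continuous_subspaceT.
Qed.

Lemma continuous_norm f : continuous f -> continuous (fun x => `|f x|).
Proof. by move=> cf x; apply: cvg_norm; exact: cf. Qed.

Lemma continuous_affine f (k l : R) : continuous f ->
  continuous (fun x => k * f x + l).
Proof.
move=> cf x; apply: cvgD; last exact: cvg_cst.
by apply: cvgM; [exact: cvg_cst|exact: cf].
Qed.

(** The degenerate interval is allowed because a sign change used as a splitting point may fall on
    an endpoint. *)
Lemma Rintegral_FTC2 G g a b : a <= b -> continuous g ->
  (forall x : R, is_derive x (1 : R) G (g x)) ->
  \int[mu]_(x in `[a, b]) g x = G b - G a.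
Proof.
rewrite le_eqVlt => /predU1P[->|ab] cg dG.
  by rewrite set_itv1 Rintegral_set1 subrr.
have cG := is_derive_continuous dG.
rewrite /Rintegral (@continuous_FTC2 _ _ G)//.
- exact: continuous_subspaceT.
- split.
  + by move=> x _; exact: ex_derive.
  + by apply: cvg_at_right_filter; exact: cG.
  + by apply: cvg_at_left_filter; exact: cG.
- by move=> x _; rewrite derive1E derive_val.
Qed.

Lemma Rintegral_itv_split g a c b : a <= c <= b -> continuous g ->
  \int[mu]_(x in `[a, b]) g x =
  \int[mu]_(x in `[a, c]) g x + \int[mu]_(x in `[c, b]) g x.
Proof.
move=> /andP[ac cb] cg.
have := @Rintegral_itvB R g (BLeft a) (BRight b) c.
rewrite Rintegral_itv_obnd_cbnd; last first.
  apply: integrableS (continuous_integrable_itv c b cg) => //.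
  by apply: subset_itvr; rewrite bnd_simp.
move=> <-; rewrite ?bnd_simp ?subrKC//.
exact: continuous_integrable_itv.
Qed.

Lemma Rintegral_norm_ge0 G g a b : a <= b -> continuous g ->
  (forall x : R, is_derive x (1 : R) G (g x)) ->
  (forall x, a <= x <= b -> 0 <= g x) ->
  \int[mu]_(x in `[a, b]) `|g x| = G b - G a.
Proof.
move=> ab cg dG g0; rewrite -(Rintegral_FTC2 ab cg dG).
by apply: eq_Rintegral => x; rewrite inE/= in_itv/= => xab; rewrite ger0_norm ?g0.
Qed.

Lemma Rintegral_norm_le0 G g a b : a <= b -> continuous g ->
  (forall x : R, is_derive x (1 : R) G (g x)) ->
  (forall x, a <= x <= b -> g x <= 0) ->
  \int[mu]_(x in `[a, b]) `|g x| = G a - G b.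
Proof.
move=> ab cg dG g0.
rewrite -[RHS]opprB -(Rintegral_FTC2 ab cg dG) -mulN1r -RintegralZl//; last first.
  exact: continuous_integrable_itv.
apply: eq_Rintegral => x; rewrite inE/= in_itv/= => xab.
by rewrite ler0_norm ?g0// mulN1r.
Qed.

(** Twice the mean over the segment, with [C] standing for [cos th]; the normalization is left to
    [law_absdev]. *)
Definition segment_absdev (C s : R) : R := \int[mu]_(t in `[- 1, 1]) `|t * C - s|.

(** [pi] times the mean over the arc, since the point at angle [t] has component [cos (t - th)]
    along [e]. *)
Definition arc_absdev (th s : R) : R :=
  \int[mu]_(t in `[0, pi]) `|cos (t - th) - s|.

Let segment_prim C s : R -> R := (C / 2) \*: (id * id) - s \*: id.

Let segment_primE C s t : segment_prim C s t = C / 2 * (t * t) - s * t.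
Proof. by []. Qed.

Let is_derive_segment C s (t : R) :
  is_derive t (1 : R) (segment_prim C s) (t * C - s).
Proof.
have di := @is_derive_id R R t 1.
refine (is_derive_eq (is_deriveB (is_deriveZ _ (is_deriveM di di))
  (is_deriveZ _ di)) _).
by rewrite /GRing.scale/=; field.
Qed.

Lemma continuous_segment C s : continuous (fun t : R => t * C - s).
Proof.
apply: (@is_derive_continuous _ (fun=> C)) => t.
rewrite (_ : (fun _ => _) = C \*: id - cst s); last first.
  by apply/funext => u; rewrite !fctE/= /GRing.scale/= mulrC.
have di := @is_derive_id R R t 1.
refine (is_derive_eq (is_deriveB (is_deriveZ _ di) (is_derive_cst _ _ _)) _).
by rewrite subr0 /GRing.scale/= mulr1.
Qed.

Lemma segment_absdev1 s : `|s| <= 1 -> segment_absdev 1 s = 1 + s ^+ 2.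
Proof.
rewrite ler_norml => /andP[s1 s2]; rewrite /segment_absdev.
rewrite (@Rintegral_itv_split _ _ s) ?s1//; last exact/continuous_norm/continuous_segment.
rewrite (Rintegral_norm_le0 s1 (@continuous_segment _ _) (is_derive_segment _ _)); last first.
  by move=> x /andP[_ xs]; rewrite mulr1 subr_le0.
rewrite (Rintegral_norm_ge0 s2 (@continuous_segment _ _) (is_derive_segment _ _)); last first.
  by move=> x /andP[xs _]; rewrite mulr1 subr_ge0.
by rewrite !segment_primE; field.
Qed.

(** The bisector leaves the whole segment on one side, so the integrand has constant sign. *)
Lemma segment_absdev_out C s : `|C| <= s -> segment_absdev C s = 2 * s.
Proof.
move=> Cs; rewrite /segment_absdev.
have N11 : -1 <= 1 :> R by lra.
rewrite (Rintegral_norm_le0 N11 (@continuous_segment _ _) (is_derive_segment _ _)); last first.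
  move=> t t1; rewrite subr_le0 (le_trans (ler_norm _))// normrM (le_trans _ Cs)//.
  by rewrite ler_piMl// ler_norml.
by rewrite !segment_primE; field.
Qed.

Lemma segment_absdevN C s : segment_absdev (- C) (- s) = segment_absdev C s.
Proof.
apply: eq_Rintegral => t _.
by rewrite mulrN -opprD normrN.
Qed.

(* [t C - s = C (t - s) - (1 - C) s] reduces the bound to [C = 1]. *)
Lemma segment_absdev_le C s : 0 <= C <= 1 -> `|s| <= 1 ->
  segment_absdev C s <= 1 + s ^+ 2.
Proof.
move=> /andP[C0 C1] s1.
apply: (@le_trans _ _ (\int[mu]_(t in `[- 1, 1]) (C * `|t * 1 - s| + (1 - C) * `|s|))).
  apply: le_Rintegral => //.
  - exact/continuous_integrable_itv/continuous_norm/continuous_segment.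
  - exact/continuous_integrable_itv/continuous_affine/continuous_norm/continuous_segment.
  move=> t _; rewrite mulr1.
  rewrite (_ : t * C - s = C * (t - s) - (1 - C) * s); last by ring.
  have C1' : 0 <= 1 - C by rewrite subr_ge0.
  by rewrite (le_trans (ler_normB _ _))// !normrM (ger0_norm C0) (ger0_norm C1').
rewrite RintegralD//; last 2 first.
- rewrite (_ : (fun _ => _) = (fun t => C * `|t * 1 - s| + 0)); last first.
    by apply/funext => t; rewrite addr0.
  exact/continuous_integrable_itv/continuous_affine/continuous_norm/continuous_segment.
- by apply: continuous_integrable_itv => t; exact: cvg_cst.
rewrite RintegralZl//; last first.
  exact/continuous_integrable_itv/continuous_norm/continuous_segment.
rewrite -/(segment_absdev 1 s) segment_absdev1//.
have -> : \int[mu]_(_ in `[- 1, 1]) ((1 - C) * `|s|) = 2 * ((1 - C) * `|s|).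
  have N11 : -1 <= 1 :> R by lra.
  set k : R := (1 - C) * `|s|.
  have ck : continuous (fun _ : R => k) by move=> t; exact: cvg_cst.
  have dk (t : R) : is_derive t (1 : R) (k \*: id) k.
    refine (is_derive_eq (is_deriveZ _ (is_derive_id _ _)) _).
    by rewrite /GRing.scale/= mulr1.
  rewrite (Rintegral_FTC2 N11 ck dk) (_ : (k \*: id) 1 = k * 1)//.
  by rewrite (_ : (k \*: id) (- 1) = k * - 1)//; ring.
rewrite -[s ^+ 2]real_normK ?num_real//.
set m := `|s| in s1 *; have m0 : 0 <= m by exact: normr_ge0.
(* This product is exactly [1 + m^2 - (C (1 + m^2) + 2 (1 - C) m)]. *)
have : 0 <= (1 - C) * (1 - m) ^+ 2 by rewrite mulr_ge0 ?sqr_ge0// subr_ge0.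
lra.
Qed.

(** * Absolute deviation over the arc *)

Lemma cos_le_of_norm al x : `|x| <= al <= pi -> cos al <= cos x.
Proof.
move=> /andP[xal alpi]; have x0 := normr_ge0 x.
by rewrite -[cos x]cos_norm ler_cos ?in_itv/=; lra.
Qed.

(** Beyond [pi], the reflection [x -> 2 * pi - x] returns to the range where cosine decreases. *)
Lemma cos_le_of_ge al x : 0 <= al -> al <= x -> x + al <= 2 * pi -> cos x <= cos al.
Proof.
move=> al0 alx xal; have p0 := pi_gt0 R.
have [xpi|/ltW xpi] := leP x pi.
  by rewrite ler_cos ?in_itv/=; lra.
rewrite -[x](subrK (pi *+ 2)) cosD2pi -cosN opprB mulr2n.
by rewrite ler_cos ?in_itv/=; lra.
Qed.

(** The antiderivative [sin (t - th) - s * t], expanded so that only sine and cosine of [t] itself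
    are differentiated. *)
Let prim th s : R -> R := cos th \*: @sin R - sin th \*: @cos R - s \*: id.

Let primE th s t : prim th s t = sin (t - th) - s * t.
Proof. by rewrite sinB [sin t * _]mulrC [cos t * _]mulrC. Qed.

Let is_derive_cos_shift th s (t : R) :
  is_derive t (1 : R) (prim th s) (cos (t - th) - s).
Proof.
have di := @is_derive_id R R t 1.
have ds := @is_derive_sin R t; have dc := @is_derive_cos R t.
refine (is_derive_eq (is_deriveB (is_deriveB (is_deriveZ _ ds) (is_deriveZ _ dc))
  (is_deriveZ _ di)) _).
by rewrite /GRing.scale/= cosB; ring.
Qed.

Lemma continuous_cos_shift th s : continuous (fun t : R => cos (t - th) - s).
Proof.
apply: (@is_derive_continuous _ (fun t => cos th * - sin t + sin th * cos t)) => t.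
rewrite (_ : (fun _ => _) = cos th \*: @cos R + sin th \*: @sin R - cst s); last first.
  by apply/funext => u; rewrite !fctE/= /GRing.scale/= cosB
    [cos th * _]mulrC [sin th * _]mulrC.
have ds := @is_derive_sin R t; have dc := @is_derive_cos R t.
refine (is_derive_eq (is_deriveB (is_deriveD (is_deriveZ _ dc) (is_deriveZ _ ds))
  (is_derive_cst _ _ _)) _).
by rewrite subr0.
Qed.

Let sin_piB th : sin (pi - th) = sin th.
Proof. by rewrite sinB sinpi cospi mul0r mulN1r sub0r opprK. Qed.

(** The integrand changes sign at [t = th + pi / 2 - b]. The hypothesis puts this point in [[0, pi]]
    and keeps the other zeros of the integrand out of the interior. *)
Lemma arc_absdev_crossing th b : `|th| + `|b| <= pi / 2 ->
  arc_absdev th (sin b) = 2 * (cos b + b * sin b) - 2 * th * sin b.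
Proof.
move=> thb; have p0 := pi_gt0 R.
have [th1 th2] : th <= `|th| /\ - th <= `|th| by rewrite ler_norm -normrN ler_norm.
have [b1 b2] : b <= `|b| /\ - b <= `|b| by rewrite ler_norm -normrN ler_norm.
have E : cos (pi / 2 - b) = sin b by rewrite -cosN opprB cosBpihalf.
have c0 : 0 <= th + (pi / 2 - b) by lra.
have c1 : th + (pi / 2 - b) <= pi by lra.
rewrite /arc_absdev (@Rintegral_itv_split _ _ (th + (pi / 2 - b))) ?c0 ?c1//; last first.
  exact/continuous_norm/continuous_cos_shift.
rewrite (Rintegral_norm_ge0 c0 (@continuous_cos_shift _ _)
  (is_derive_cos_shift _ _)); last first.
  move=> x /andP[x0 xc]; rewrite subr_ge0 -E cos_le_of_norm// ler_norml.
  by apply/andP; split; [apply/andP; split|]; lra.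
rewrite (Rintegral_norm_le0 c1 (@continuous_cos_shift _ _)
  (is_derive_cos_shift _ _)); last first.
  by move=> x /andP[x0 xc]; rewrite subr_le0 -E cos_le_of_ge; lra.
rewrite !primE sub0r sinN sin_piB.
have -> : sin (th + (pi / 2 - b) - th) = cos b.
  by rewrite addrAC subrr add0r -cosBpihalf addrAC subrr add0r cosN.
by move: (pi : R) => q; field.
Qed.

(** Only the cap [th - al <= t <= th + al] lies beyond the bisector. The last term is twice the
    integral of [cos (t - th) - cos al] over this cap. *)
Lemma arc_absdev_cap th al : 0 <= al -> al <= th -> th + al <= pi ->
  arc_absdev th (cos al) =
  pi * cos al - 2 * sin th + 4 * (sin al - al * cos al).
Proof.
move=> al0 alth thal; have p0 := pi_gt0 R.
have c0 : 0 <= th - al by lra.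
have c1 : th - al <= th + al by lra.
have c01 : 0 <= th - al <= pi by apply/andP; split; lra.
have c12 : th - al <= th + al <= pi by apply/andP; split; lra.
have cN := continuous_norm (@continuous_cos_shift th (cos al)).
rewrite /arc_absdev (Rintegral_itv_split c01 cN) (Rintegral_itv_split c12 cN).
rewrite (Rintegral_norm_le0 c0 (@continuous_cos_shift _ _)
  (is_derive_cos_shift _ _)); last first.
  move=> x /andP[x0 xc]; rewrite subr_le0 -cosN opprB.
  by rewrite cos_le_of_ge; lra.
rewrite (Rintegral_norm_ge0 c1 (@continuous_cos_shift _ _)
  (is_derive_cos_shift _ _)); last first.
  move=> x /andP[x0 xc]; rewrite subr_ge0 cos_le_of_norm// ler_norml.
  by apply/andP; split; [apply/andP; split|]; lra.
rewrite (Rintegral_norm_le0 thal (@continuous_cos_shift _ _)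
  (is_derive_cos_shift _ _)); last first.
  move=> x /andP[x0 xc]; rewrite subr_le0.
  by rewrite cos_le_of_ge; lra.
rewrite !primE sub0r !sinN sin_piB.
have -> : th - al - th = - al by ring.
have -> : th + al - th = al by ring.
by rewrite sinN; move: (pi : R) => q; ring.
Qed.

Lemma arc_absdev_below th s : (forall t, 0 <= t <= pi -> cos (t - th) <= s) ->
  arc_absdev th s = pi * s - 2 * sin th.
Proof.
move=> ths; have p0 := pi_ge0 R.
rewrite /arc_absdev.
rewrite (Rintegral_norm_le0 p0 (@continuous_cos_shift _ _)
  (is_derive_cos_shift _ _)); last first.
  by move=> x x0; rewrite subr_le0 ths.
rewrite !primE sub0r sinN sin_piB.
by move: (pi : R) => q; ring.
Qed.

(** Reversing the unit normal, together with the sign of the offset, describes the same bisector. *)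
Lemma arc_absdevDpi th s : arc_absdev (th + pi) (- s) = arc_absdev th s.
Proof.
apply: eq_Rintegral => t _.
have -> : cos (t - (th + pi)) = - cos (t - th).
  by rewrite -[t - th](subrK pi) cosDpi opprK opprD addrA.
by rewrite -opprD normrN.
Qed.

End integrals.

(** * The key bound on the mean absolute deviation of the law *)

Section absdev_bound.
Variable R : realType.
Implicit Types th s : R.

(* E|X.1 cos th + X.2 sin th - s| for X of law [segment_arc_law R]. *)
Definition law_absdev th s : R :=
  segment_absdev (cos th) s / 4 + arc_absdev th s / (2 * pi).

Let pN0 : (pi : R) != 0. Proof. by rewrite gt_eqF ?pi_gt0. Qed.

Lemma law_absdev_ge0 th s : 0 <= law_absdev th s.
Proof.
by rewrite addr_ge0// divr_ge0 ?mulr_ge0 ?pi_ge0//; apply: Rintegral_ge0.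
Qed.

Lemma law_absdevDpi th s : law_absdev (th + pi) (- s) = law_absdev th s.
Proof. by rewrite /law_absdev arc_absdevDpi cosDpi segment_absdevN. Qed.

(** The vertical axis as bisector: this value [K] makes the bound sharp. *)
Lemma law_absdev0 : law_absdev 0 0 = 4^-1 + pi^-1.
Proof.
have p0 := pi_gt0 R.
rewrite /law_absdev cos0 segment_absdev1 ?normr0// expr0n addr0 div1r -{2}sin0.
rewrite arc_absdev_crossing ?normr0 ?addr0 ?divr_ge0// ?pi_ge0//.
rewrite cos0 sin0 !mulr0 subr0 addr0 mulr1 invfM mulrA divff ?mul1r// pnatr_eq0.
Qed.

(** The endpoints have components [cos th] and [- cos th] along [e], so [|s| <= cos th] says that
    the bisector separates them. The segment contributes at most [(1 + s^2) / 4], the arc at most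
    [1/pi + s^2 / 4 - th s / pi]. *)
Lemma law_absdev_le_crossing th s : - (pi / 2) <= th <= pi / 2 ->
  `|s| <= cos th ->
  law_absdev th s <= 4^-1 + pi^-1 + s ^+ 2 / 2 - pi^-1 * th * s.
Proof.
move=> thI sC; have p0 := pi_gt0 R; have C1 := cos_le1 th.
have sI : - 1 <= s <= 1 by rewrite -ler_norml (le_trans sC).
have thn : `|th| <= pi / 2 by rewrite ler_norml.
have b1 := asin_geNpi2 sI; have b2 := asin_lepi2 sI.
have sE : sin (asin s) = s by rewrite asinK// in_itv/=.
set b := asin s in b1 b2 sE.
have sN : `|sin b| = sin `|b|.
  have [b0|b0] := leP 0 b; first by rewrite !ger0_norm// sin_ge0_pi//; lra.
  rewrite [in RHS]ltr0_norm// sinN ler0_norm// -oppr_ge0 -sinN sin_ge0_pi//; lra.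
have bn : `|b| <= pi / 2 by rewrite ler_norml b1.
(* Since [sin |b| = |s| <= cos th = sin (pi / 2 - |th|)] and sine increases on this range. *)
have thb : `|th| + `|b| <= pi / 2.
  have [n1 n2] := (normr_ge0 th, normr_ge0 b).
  rewrite -lerBrDl leNgt; apply/negP => hb.
  have : sin (pi / 2 - `|th|) < sin `|b| by rewrite ltr_sin// in_itv/=; lra.
  by rewrite -sN sE addrC sinDpihalf cosN cos_norm ltNge sC.
have H1 : segment_absdev (cos th) s <= 1 + s ^+ 2.
  apply: segment_absdev_le; last by rewrite ler_norml.
  by rewrite cos_ge0_pihalf.
have H2 : cos b + b * sin b <= 1 + pi / 4 * sin b ^+ 2.
  by apply: cosD_mul_sin_le; rewrite b1.
rewrite /law_absdev -[X in arc_absdev _ X]sE arc_absdev_crossing// sE.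
rewrite sE in H2.
have -> : (2 * (cos b + b * s) - 2 * th * s) / (2 * pi) =
    pi^-1 * (cos b + b * s) - pi^-1 * th * s.
  by move: (pi : R) pN0 => q qN0; field.
have H3 : pi^-1 * (cos b + b * s) <= pi^-1 * (1 + pi / 4 * s ^+ 2).
  by rewrite ler_wpM2l// invr_ge0 ltW.
have H4 : pi^-1 * (1 + pi / 4 * s ^+ 2) = pi^-1 + s ^+ 2 / 4.
  by move: (pi : R) pN0 => q qN0; field.
by rewrite H4 in H3; lra.
Qed.

(** Both endpoints lie below the bisector. If the arc does too, the deviation equals [s - E<X, e>]
    and the gap is [K^2]; otherwise a cap of half-angle [acos s] is cut off. The range of [th] also
    accommodates a direction turned by [pi]. *)
Lemma law_absdev_lt_noncrossing th s : - (pi / 2) <= th <= 3 * pi / 2 -> `|cos th| < s ->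
  law_absdev th s ^+ 2 < (4^-1 + pi^-1) ^+ 2 + (s - pi^-1 * sin th) ^+ 2.
Proof.
move=> /andP[thl thr] Cs; have p0 := pi_gt0 R.
have q0 : 0 < pi^-1 :> R by rewrite invr_gt0.
have segE : segment_absdev (cos th) s = 2 * s by rewrite segment_absdev_out// ltW.
have below : (forall t, 0 <= t <= pi -> cos (t - th) <= s) ->
    law_absdev th s ^+ 2 < (4^-1 + pi^-1) ^+ 2 + (s - pi^-1 * sin th) ^+ 2.
  move=> le_s; rewrite /law_absdev segE arc_absdev_below//.
  have -> : 2 * s / 4 + (pi * s - 2 * sin th) / (2 * pi) = s - pi^-1 * sin th.
    by move: (pi : R) pN0 => q qN0; field.
  by rewrite ltrDr exprn_gt0//; lra.
have [s1|s1] := leP 1 s.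
  by apply: below => t _; rewrite (le_trans (cos_le1 _)).
have [S0|S0] := leP (sin th) 0.
  apply: below => t tI; rewrite cosB.
  have H1 : 0 <= sin t * - sin th by rewrite mulr_ge0 ?sin_ge0_pi// oppr_ge0.
  have H2 : cos t * cos th <= `|cos th|.
    by rewrite (le_trans (ler_norm _))// normrM ler_piMl// cos_max.
  by lra.
have th0 : 0 < th.
  rewrite ltNge; apply/negP => th0.
  by have := @sin_ge0_pi R (- th); rewrite sinN; lra.
have thpi : th < pi.
  rewrite ltNge; apply/negP => thpi.
  have := @sin_ge0_pi R (th - pi).
  by rewrite -[th in sin th](subrK pi) sinDpi in S0; lra.
have s0 : 0 <= s by rewrite ltW// (le_lt_trans _ Cs).
have sI : - 1 <= s <= 1 by rewrite (le_trans _ s0) ?lerN10// ltW.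
have al0 := acos_ge0 sI; have alpi := acos_lepi sI.
have alE : cos (acos s) = s by rewrite acosK// in_itv/=.
set al := acos s in al0 alpi alE.
have [C1 C2] : cos th < s /\ - cos th < s by move: Cs; rewrite ltr_norml; lra.
(* From [|cos th| < cos al], the cap stays within the arc, and likewise [sin al <= sin th]. *)
have althp : al <= th.
  rewrite leNgt; apply/negP => h.
  by have : cos al < cos th by [rewrite ltr_cos// in_itv/=; lra]; lra.
have althm : th + al <= pi.
  rewrite -lerBrDl leNgt; apply/negP => h.
  have : cos al < cos (pi - th) by rewrite ltr_cos// in_itv/=; lra.
  by rewrite cosB cospi sinpi mul0r addr0 mulN1r; lra.
have alh : al <= pi / 2.
  rewrite leNgt; apply/negP => h.
  have : cos al < cos (pi / 2) by rewrite ltr_cos// in_itv/=; lra.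
  by rewrite cos_pihalf; lra.
have sal0 : 0 <= sin al by rewrite sin_ge0_pi// al0.
have salS : sin al <= sin th.
  rewrite -(@ler_pXn2r _ 2)// ?nnegrE ?(ltW S0)// !sin2cos2 lerD2l lerN2 alE.
  by rewrite -[leLHS]real_normK ?num_real// ler_pXn2r ?nnegrE ?(ltW Cs).
have alI : 0 <= al <= pi / 2 by rewrite al0.
have := noncrossing_bound alI salS (sin_le1 th).
rewrite -[in law_absdev th s]alE /law_absdev alE segE -[in arc_absdev _ s]alE.
rewrite arc_absdev_cap// alE.
have -> : 2 * s / 4 + (pi * s - 2 * sin th + 4 * (sin al - al * s)) / (2 * pi) =
    s - pi^-1 * sin th + 2 * pi^-1 * (sin al - al * s).
  by move: (pi : R) pN0 => q qN0; field.
by [].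
Qed.

(** A bisector with [s < - cos th] is treated with the reversed normal. The bound is strict when the
    endpoints are not separated, so equality can only come from the crossing case. *)
Lemma law_absdev_bound th s : - (pi / 2) <= th <= pi / 2 ->
  law_absdev th s ^+ 2 <= (4^-1 + pi^-1) ^+ 2 + (s - pi^-1 * sin th) ^+ 2 /\
  (law_absdev th s ^+ 2 = (4^-1 + pi^-1) ^+ 2 + (s - pi^-1 * sin th) ^+ 2 ->
   s = 0 /\ sin th = 0).
Proof.
move=> /[dup] thI /andP[th1 th2]; have p0 := pi_gt0 R.
have C0 : 0 <= cos th by exact: cos_ge0_pihalf.
have [sC|] := leP `|s| (cos th).
  apply: main_crossing_bound => //.
  - rewrite [sin th ^+ 2]sin2cos2 -[s ^+ 2]real_normK ?num_real//.
    by have : `|s| ^+ 2 <= cos th ^+ 2; [rewrite ler_pXn2r|lra].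
  - exact: law_absdev_ge0.
  - exact: law_absdev_le_crossing.
suff lt_ : `|s| > cos th ->
    law_absdev th s ^+ 2 < (4^-1 + pi^-1) ^+ 2 + (s - pi^-1 * sin th) ^+ 2.
  by move=> /lt_ lt_s; split; [exact: ltW|move=> E; rewrite E ltxx in lt_s].
rewrite lter_normr => /orP[sC|sC].
  by apply: law_absdev_lt_noncrossing; [lra|rewrite ger0_norm].
have := @law_absdev_lt_noncrossing (th + pi) (- s).
rewrite law_absdevDpi cosDpi sinDpi normrN ger0_norm// mulrN -opprD sqrrN.
by apply=> //; lra.
Qed.

End absdev_bound.

(** * Distortion of a pair *)

Section pair_distortion.
Variable R : realType.
Notation mu := (@lebesgue_measure R).
Notation law := (segment_arc_law R).
Implicit Types (a b : plane R) (r th : R).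

Lemma min_sqdist_pair a b (x : plane R) :
  min_sqdist [set a; b] x = (Num.min (sqdist x a) (sqdist x b))%:E.
Proof.
rewrite /min_sqdist image_setU !image_set1; apply/eqP; rewrite eq_le; apply/andP; split.
  apply: ereal_inf_lbound; rewrite /Order.min.
  by case: ifP => _; [left|right].
by apply: le_ereal_inf_tmp => _ [->|->]; rewrite lee_fin ge_min lexx ?orbT.
Qed.

Lemma measurable_sqdist a : measurable_fun setT (fun x : plane R => sqdist x a).
Proof.
apply: measurable_funD; apply: measurable_funX; apply: measurable_funB => //.
Qed.

Lemma sqdist_ge0 (x a : plane R) : 0 <= sqdist x a.
Proof. by rewrite addr_ge0// sqr_ge0. Qed.

(** The weights are half the inverse lengths 2 and [pi] of the two curves. *)
Lemma integral_segment_arc_law (h : plane R -> R) : measurable_fun setT h ->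
  (forall x, 0 <= h x) ->
  (\int[law]_x (h x)%:E =
   4^-1%:E * \int[mu]_(t in `[(- 1)%R, 1%R]) (h (segment_param t))%:E +
   ((2 * pi)^-1)%:E * \int[mu]_(t in `[0%R, pi]) (h (arc_param t))%:E)%E.
Proof.
move=> mh h0.
have mEh : measurable_fun setT (EFin \o h) by exact/measurable_EFinP.
have Eh0 x : (0 <= (EFin \o h) x)%E by rewrite lee_fin.
transitivity (\int[half_mixture (uniform_segment R) (uniform_arc R)]_x (EFin \o h) x)%E => //.
rewrite /half_mixture ge0_integral_measure_add//.
rewrite !ge0_integral_mscale//=; last 2 first.
- by move=> x _; exact: Eh0.
- by move=> x _; exact: Eh0.
rewrite /uniform_segment /uniform_arc.
rewrite (ge0_integral_distribution _ mEh Eh0) (ge0_integral_distribution _ mEh Eh0).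
have mS := measurableT_comp mEh (@measurable_segment_param R).
have mA := measurableT_comp mEh (@measurable_arc_param R).
rewrite (integral_uniform (ltrN11 R) mS (fun=> Eh0 _)).
rewrite (integral_uniform (pi_gt0 R) mA (fun=> Eh0 _)).
rewrite !muleA -!EFinM opprK subr0 invfM.
by congr ((_%:E * _ + _)%E); rewrite -invfM; congr (_^-1); ring.
Qed.

Let integral_subZ_norm (f : R -> R) (k : R) (g : R -> R) (l u : R) :
  l <= u -> continuous f -> continuous g ->
  (\int[mu]_(t in `[l, u]) (f t - k * `|g t|)%:E)%E =
  (\int[mu]_(t in `[l, u]) f t - k * \int[mu]_(t in `[l, u]) `|g t|)%:E.
Proof.
move=> lu cf cg.
have ig := continuous_integrable_itv l u (continuous_norm cg).
have ikg : mu.-integrable `[l, u] (EFin \o (fun t => k * `|g t|)).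
  apply: continuous_integrable_itv => t.
  by apply: cvgM; [exact: cvg_cst|exact: continuous_norm].
have icf := continuous_integrable_itv l u cf.
rewrite -RintegralZl// -RintegralB// /Rintegral fineK//.
apply: integrable_fin_num => //.
by apply: (integrableB _ icf ikg).
Qed.

(** The law has [E|X|^2 = 2/3] and mean [(0, 1/pi)]; the pair is given by its midpoint,
    half-distance and direction. *)
Lemma distortion_pair (c1 c2 : R) r th : 0 <= r ->
  distortion law [set (c1 + r * cos th, c2 + r * sin th);
                      (c1 - r * cos th, c2 - r * sin th)] =
  (2 / 3 + c1 ^+ 2 + c2 ^+ 2 + r ^+ 2 - 2 * c2 * pi^-1 -
   2 * r * law_absdev th (c1 * cos th + c2 * sin th))%:E.
Proof.
move=> r0; set C := cos th; set S := sin th; set s := c1 * C + c2 * S.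
set a := (c1 + _, _); set b := (c1 - _, _).
have CS : C ^+ 2 + S ^+ 2 = 1 by exact: cos2Dsin2.
have minE (x : plane R) : Num.min (sqdist x a) (sqdist x b) =
    (x.1 - c1) ^+ 2 + (x.2 - c2) ^+ 2 + r ^+ 2 -
    2 * r * `|x.1 * C + x.2 * S - s|.
  (* The minimum is half the sum minus half the absolute difference, and the difference of the
     squared distances is affine in [x]. *)
  rewrite minr_absE /sqdist /=.
  have -> : (x.1 - (c1 + r * C)) ^+ 2 + (x.2 - (c2 + r * S)) ^+ 2 -
     ((x.1 - (c1 - r * C)) ^+ 2 + (x.2 - (c2 - r * S)) ^+ 2) =
     - (4 * r) * (x.1 * C + x.2 * S - s) by rewrite /s; ring.
  rewrite normrM normrN (ger0_norm (_ : 0 <= 4 * r)) ?mulr_ge0//.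
  by have -> : r ^+ 2 = r ^+ 2 * (C ^+ 2 + S ^+ 2); [rewrite CS mulr1|field].
rewrite /distortion.
under eq_integral do rewrite min_sqdist_pair.
rewrite integral_segment_arc_law; last 2 first.
- by apply: measurable_minr; exact: measurable_sqdist.
- by move=> x; rewrite le_min !sqdist_ge0.
have N11 : -1 <= 1 :> R by lra.
have -> : (\int[mu]_(t in `[(- 1)%R, 1%R])
    (Num.min (sqdist (segment_param t) a) (sqdist (segment_param t) b))%:E)%E =
    (2 / 3 + 2 * (c1 ^+ 2 + c2 ^+ 2 + r ^+ 2) - 2 * r * segment_absdev C s)%:E.
  pose f (t : R) : R := (t - c1) * (t - c1) + (c2 ^+ 2 + r ^+ 2).
  pose G : R -> R := 3^-1 \*: (id * (id * id)) - c1 \*: (id * id) +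
    (c1 ^+ 2 + c2 ^+ 2 + r ^+ 2) \*: id.
  have dG (t : R) : is_derive t (1 : R) G (f t).
    have di := @is_derive_id R R t 1; have di2 := is_deriveM di di.
    refine (is_derive_eq (is_deriveD (is_deriveB (is_deriveZ _ (is_deriveM di di2))
      (is_deriveZ _ di2)) (is_deriveZ _ di)) _).
    by rewrite /f !fctE /GRing.scale/=; field.
  have cf : continuous f.
    move=> t; have ct : (fun u : R => u - c1) @ t --> t - c1.
      by apply: cvgB; [exact: cvg_id|exact: cvg_cst].
    by apply: cvgD; [exact: (cvgM ct ct)|exact: cvg_cst].
  transitivity (\int[mu]_(t in `[(- 1)%R, 1%R]) (f t - 2 * r * `|t * C - s|)%:E)%E.
    apply: eq_integral => t _; rewrite minE /f/= mul0r addr0 sub0r sqrrN expr2.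
    by congr (_%:E); rewrite !addrA.
  rewrite integral_subZ_norm//; last exact: continuous_segment.
  rewrite (Rintegral_FTC2 N11 cf dG) -/(segment_absdev C s).
  congr ((_ - _)%:E).
  have GE t : G t = 3^-1 * (t * (t * t)) - c1 * (t * t) +
    (c1 ^+ 2 + c2 ^+ 2 + r ^+ 2) * t by [].
  by rewrite !GE; field.
have -> : (\int[mu]_(t in `[0%R, pi])
    (Num.min (sqdist (arc_param t) a) (sqdist (arc_param t) b))%:E)%E =
    (pi * (1 + c1 ^+ 2 + c2 ^+ 2 + r ^+ 2) - 4 * c2 - 2 * r * arc_absdev th s)%:E.
  pose A : R := 1 + c1 ^+ 2 + c2 ^+ 2 + r ^+ 2.
  pose f (t : R) : R := A - (2 * c1) * cos t - (2 * c2) * sin t.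
  pose G : R -> R := A \*: id - (2 * c1) \*: @sin R + (2 * c2) \*: @cos R.
  have dG (t : R) : is_derive t (1 : R) G (f t).
    have di := @is_derive_id R R t 1.
    have ds := @is_derive_sin R t; have dc := @is_derive_cos R t.
    refine (is_derive_eq (is_deriveD (is_deriveB (is_deriveZ _ di)
      (is_deriveZ _ ds)) (is_deriveZ _ dc)) _).
    by rewrite /f /GRing.scale/= mulr1 mulrN.
  have cf : continuous f.
    move=> t; apply: cvgB; first apply: cvgB.
    - exact: cvg_cst.
    - by apply: cvgM; [exact: cvg_cst|exact: continuous_cos].
    - by apply: cvgM; [exact: cvg_cst|exact: continuous_sin].
  transitivity (\int[mu]_(t in `[0%R, pi]) (f t - 2 * r * `|cos (t - th) - s|)%:E)%E.
    apply: eq_integral => t _; rewrite minE /f/= cosB; congr (_%:E).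
    congr (_ - _).
    by have := cos2Dsin2 t; rewrite /A; lra.
  rewrite integral_subZ_norm ?pi_ge0//; last exact: continuous_cos_shift.
  rewrite (Rintegral_FTC2 (pi_ge0 R) cf dG) -/(arc_absdev th s).
  congr ((_ - _)%:E).
  have GE t : G t = A * t - 2 * c1 * sin t + 2 * c2 * cos t by [].
  rewrite !GE sinpi cospi sin0 cos0 /A.
  by move: (pi : R) => q; ring.
rewrite -!EFinM -EFinD /law_absdev -/C; congr (_%:E).
have : (pi : R) != 0 by rewrite gt_eqF ?pi_gt0.
by move: (pi : R) => q qN0; field.
Qed.

End pair_distortion.

(** * Optimality *)

Section two_means.
Variable R : realType.
Notation law := (segment_arc_law R).

(** The points [a] and [b] may coincide. The map [g] only covers [A], so [g 0] and [g 1] may lie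
    outside [A], whence four cases. *)
Lemma card_le_I2 (T : pointedType) (A : set T) :
  (A #<= `I_2)%card <-> A = set0 \/ exists a b, A = [set a; b].
Proof.
split=> [/pcard_surjP[g gA]|[->|[a [b ->]]]]; last 2 first.
- exact: card_ge0.
- apply/pcard_surjP; exists (fun n => if n == 0%N then a else b) => _ [->|->].
  + by exists 0%N.
  + by exists 1%N.
have Ag x : A x -> x = g 0 \/ x = g 1.
  by move=> /gA[[|[|//]] _ <-]; [left|right].
have [A0|A0] := pselect (A (g 0)); have [A1|A1] := pselect (A (g 1)).
- right; exists (g 0), (g 1); apply/seteqP; split=> x; first exact: Ag.
  by case=> ->.
- right; exists (g 0), (g 0); apply/seteqP; split=> x; last by case=> ->.
  by move=> /[dup] /Ag[->|-> //]; left.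
- right; exists (g 1), (g 1); apply/seteqP; split=> x; last by case=> ->.
  by move=> /[dup] /Ag[-> //|->]; left.
- left; apply/seteqP; split=> // x /[dup] /Ag[->|->] //.
Qed.

Lemma polar_right_half_plane (d1 d2 : R) : 0 <= d1 -> exists th r : R,
  [/\ 0 <= r, - (pi / 2) <= th <= pi / 2, d1 = r * cos th & d2 = r * sin th].
Proof.
move=> d10; have p0 := pi_gt0 R.
pose r := Num.sqrt (d1 ^+ 2 + d2 ^+ 2).
have r2 : r ^+ 2 = d1 ^+ 2 + d2 ^+ 2 by rewrite sqr_sqrtr// addr_ge0// sqr_ge0.
have [r00|rN0] := eqVneq r 0.
  exists 0, 0; rewrite !mul0r lexx.
  have : d1 ^+ 2 + d2 ^+ 2 = 0 by rewrite -r2 r00 expr0n.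
  have [h1 h2] := (sqr_ge0 d1, sqr_ge0 d2) => h.
  have /eqP : d1 ^+ 2 = 0 by lra.
  have /eqP : d2 ^+ 2 = 0 by lra.
  by rewrite !sqrf_eq0 => /eqP -> /eqP ->; split=> //; lra.
have r0 : 0 < r by rewrite lt_neqAle eq_sym rN0 sqrtr_ge0.
pose x := d2 / r.
have x2 : 1 - x ^+ 2 = (d1 / r) ^+ 2.
  have d1E : d1 ^+ 2 = r ^+ 2 - d2 ^+ 2 by rewrite r2 addrK.
  by rewrite /x !expr_div_n d1E mulrBl divff ?expf_neq0.
have xI : - 1 <= x <= 1.
  by rewrite -ler_norml -(@ler_pXn2r _ 2)// ?nnegrE// expr1n real_normK
    ?num_real// -subr_ge0 x2 sqr_ge0.
exists (asin x), r; split; first exact: ltW.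
- by rewrite asin_geNpi2// asin_lepi2.
- by rewrite cos_asin// x2 sqrtr_sqr ger0_norm ?divr_ge0 ?(ltW r0)// mulrC divfK.
- by rewrite asinK ?in_itv//= mulrC divfK.
Qed.

(** Take the midpoint and the half-difference; swapping the two points puts the latter in the right
    half-plane. *)
Lemma pair_polar (a b : plane R) : exists c1 c2 r th : R,
  [/\ 0 <= r, - (pi / 2) <= th <= pi / 2 &
    [set a; b] = [set (c1 + r * cos th, c2 + r * sin th);
                      (c1 - r * cos th, c2 - r * sin th)]].
Proof.
have p0 := pi_gt0 R.
wlog ab : a b / b.1 <= a.1 => [H|].
  have [/H//|/ltW/H] := leP b.1 a.1.
  by rewrite setUC.
pose d1 := (a.1 - b.1) / 2; pose d2 := (a.2 - b.2) / 2.
have d10 : 0 <= d1 by rewrite divr_ge0// subr_ge0.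
have [th [r [r0 thI d1E d2E]]] := polar_right_half_plane d2 d10.
exists ((a.1 + b.1) / 2), ((a.2 + b.2) / 2), r, th; split=> //.
rewrite -d1E -d2E /d1 /d2.
case: a b {ab d10 d1 d2 d1E d2E} => [a1 a2] [b1 b2] /=.
by congr [set (_, _); (_, _)]; field.
Qed.

Lemma distortion_set0 : distortion law set0 = +oo%E.
Proof.
rewrite /distortion (_ : min_sqdist set0 = cst +oo%E); last first.
  by apply/funext => x; rewrite /min_sqdist image_set0 ereal_inf0.
by rewrite integral_cst// [X in (_ * X)%E]probability_setT mule1.
Qed.

(** The total variance [2/3 - 1/pi^2] of the law, minus [K^2]. *)
Let V2 : R := 2 / 3 - pi^-1 ^+ 2 - (4^-1 + pi^-1) ^+ 2.

Let opt : set (plane R) := [set (- (1 / 4) - 1 / pi, 1 / pi); (1 / 4 + 1 / pi, 1 / pi)].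

(** The polar form with midpoint [(0, 1/pi)], radius [K] and [th = 0]; the factors 1 and 0 are
    [cos 0] and [sin 0]. *)
Let optE : opt = [set (0 + (4^-1 + pi^-1) * 1, pi^-1 + (4^-1 + pi^-1) * 0);
                      (0 - (4^-1 + pi^-1) * 1, pi^-1 - (4^-1 + pi^-1) * 0)].
Proof.
by rewrite /opt setUC mulr0 mulr1 addr0 subr0 add0r sub0r opprD !div1r.
Qed.

Lemma distortion_opt : distortion law opt = V2%:E.
Proof.
have := @distortion_pair R 0 pi^-1 (4^-1 + pi^-1) 0.
rewrite cos0 sin0 -optE => ->; last by rewrite addr_ge0 ?invr_ge0 ?pi_ge0.
rewrite mul0r add0r mulr0 law_absdev0 /V2; congr (_%:E).
by move: (pi^-1 : R) => p; field.
Qed.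

(** The excess over [V2] is [(r - F)^2], plus the slack of the deviation bound, plus the squared
    component of [c - E X] orthogonal to [e]. When it is zero all three vanish, which determines the
    pair. *)
Lemma distortion_pair_bound (c1 c2 r th : R) : 0 <= r ->
  - (pi / 2) <= th <= pi / 2 ->
  let D := 2 / 3 + c1 ^+ 2 + c2 ^+ 2 + r ^+ 2 - 2 * c2 * pi^-1 -
   2 * r * law_absdev th (c1 * cos th + c2 * sin th) in
  V2 <= D /\
  (D = V2 -> [/\ c1 = 0, c2 = pi^-1, r = 4^-1 + pi^-1, cos th = 1 & sin th = 0]).
Proof.
move=> r0 thI D.
have C0 : 0 <= cos th by exact: cos_ge0_pihalf.
have CS := cos2Dsin2 th.
have F0 := law_absdev_ge0 th (c1 * cos th + c2 * sin th).
have [le_F eq_F] := law_absdev_bound (c1 * cos th + c2 * sin th) thI.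
have K0 : 0 <= 4^-1 + pi^-1 :> R by rewrite addr_ge0 ?invr_ge0 ?pi_ge0.
rewrite /V2 /D {D}; move: le_F eq_F F0 K0.
set F := law_absdev _ _.
move: (pi^-1 : R) => p.
move: (cos th) (sin th) C0 CS => C S C0 CS le_F eq_F F0 K0.
set D := (X in _ <= X /\ _).
have E : D - (2 / 3 - p ^+ 2 - (4^-1 + p) ^+ 2) =
    (r - F) ^+ 2 + ((4^-1 + p) ^+ 2 + (c1 * C + c2 * S - p * S) ^+ 2 - F ^+ 2)
    + (c1 * S - (c2 - p) * C) ^+ 2.
  (* Multiplying by [C^2 + S^2 = 1] splits [|c - E X|^2] into its components along [e] and
     orthogonal to it. *)
  have N : c1 ^+ 2 + (c2 - p) ^+ 2 =
      (c1 ^+ 2 + (c2 - p) ^+ 2) * (C ^+ 2 + S ^+ 2) by rewrite CS mulr1.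
  transitivity ((r - F) ^+ 2 + (4^-1 + p) ^+ 2 - F ^+ 2 + (c1 ^+ 2 + (c2 - p) ^+ 2)).
    by rewrite /D; field.
  by rewrite N; ring.
have h1 := sqr_ge0 (r - F); have h2 := sqr_ge0 (c1 * S - (c2 - p) * C).
split; first by lra.
rewrite -/D => DE.
have FE : F ^+ 2 = (4^-1 + p) ^+ 2 + (c1 * C + c2 * S - p * S) ^+ 2 by lra.
have [s0 S0] := eq_F FE.
have C1 : C = 1.
  move: CS; rewrite S0 expr0n addr0 => /eqP; rewrite sqrf_eq1 => /orP[/eqP//|/eqP]; lra.
have c10 : c1 = 0 by move: s0; rewrite S0 C1 mulr1 mulr0 addr0.
have /eqP : (c1 * S - (c2 - p) * C) ^+ 2 = 0 by lra.
rewrite sqrf_eq0 c10 mul0r sub0r C1 mulr1 oppr_eq0 subr_eq0 => /eqP c2p.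
have /eqP : (r - F) ^+ 2 = 0 by lra.
rewrite sqrf_eq0 subr_eq0 => /eqP rF.
have /eqP : F ^+ 2 = (4^-1 + p) ^+ 2.
  by rewrite FE s0 S0 mulr0 subrr expr0n addr0.
rewrite eqrXn2// => /eqP FK.
by split=> //; rewrite rF.
Qed.

Lemma distortion_card2 (A : set (plane R)) : (A #<= `I_2)%card ->
  (V2%:E <= distortion law A)%E /\ (distortion law A = V2%:E -> A = opt).
Proof.
move=> /card_le_I2[->|[a [b ->]]]; first by rewrite distortion_set0 leey.
have [c1 [c2 [r [th [r0 thI ->]]]]] := pair_polar a b.
rewrite distortion_pair// lee_fin.
have [le_D eq_D] := @distortion_pair_bound c1 c2 r th r0 thI.
by split=> // -[/eq_D [-> -> -> -> ->]]; rewrite optE.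
Qed.

Lemma quantization_error2 : quantization_error law 2 = V2%:E.
Proof.
apply/eqP; rewrite eq_le; apply/andP; split.
  apply: ereal_inf_lbound; exists opt; last exact: distortion_opt.
  by apply/card_le_I2; right; do 2 eexists.
by apply: le_ereal_inf_tmp => _ [A /= A2 <-]; case: (distortion_card2 A2).
Qed.

(** [V2] decreases in [p = 1/pi], which is enclosed by [l] and [u]. The lower bound [l] carries an
    extra decimal because [V2], about 0.24236936, is nearer the upper end of the allowed
    interval. *)
Lemma V2_bounds : `|V2 - (242 * 10 ^+ 3 + 369) / 10 ^+ 6| <= 1 / 2 / 10 ^+ 6.
Proof.
have [pi1 pi2] := pi_bounds R.
have p0 := pi_gt0 R.
have q0 : 0 < pi^-1 :> R by rewrite invr_gt0.
have pV : pi^-1 * pi = 1 :> R by rewrite mulVf// gt_eqF.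
rewrite /V2; move: (pi : R) (pi^-1 : R) pi1 pi2 q0 pV => q p pi1 pi2 q0 pV.
set l : R := (3183 * 10 ^+ 4 + 985) / 10 ^+ 8.
set u : R := (3183 * 10 ^+ 3 + 101) / 10 ^+ 7.
have I1 : 0 < p * ((3141 * 10 ^+ 3 + 593) / 10 ^+ 6 - q).
  by apply: mulr_gt0 q0 _; rewrite subr_gt0.
have I2 : 0 < p * (q - (3141 * 10 ^+ 3 + 592) / 10 ^+ 6).
  by apply: mulr_gt0 q0 _; rewrite subr_gt0.
have lp : l <= p by rewrite /l; lra.
have pu : p <= u by rewrite /u; lra.
have l0 : 0 <= l by rewrite /l; lra.
clear pi1 pi2 I1 I2 pV.
(* The only non-linear quantity left is [p^2], enclosed by [l^2] and [u^2]. *)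
have J1 : 0 <= (p - l) * (p + l) by apply: mulr_ge0; lra.
have J2 : 0 <= (u - p) * (u + p) by apply: mulr_ge0; lra.
rewrite ler_norml; apply/andP; split.
  by move: J2 pu; rewrite /u; lra.
by move: J1 lp; rewrite /l; lra.
Qed.

End two_means.

Theorem proposition4p4 (R : realType) :
  let P : probability (plane R) R := segment_arc_law R in
  let V2 : R :=
    2 * ((96 - 24 * pi + 7 * pi ^+ 2) / (192 * pi ^+ 2)
         + (- 96 - 8 * pi + 17 * pi ^+ 2) / (64 * pi ^+ 2)) in
  [/\ (forall A : set (plane R),
         optimal_set_of_means P 2 A <->
         A = [set (- (1 / 4) - 1 / pi, 1 / pi);
                  (1 / 4 + 1 / pi, 1 / pi)]),
      quantization_error P 2 = V2%:E
    & `|V2 - (242 * 10 ^+ 3 + 369) / 10 ^+ 6| <= 1 / 2 / 10 ^+ 6].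
Proof.
move=> P V2.
(* Both sides equal [29/48 - 1/(2 pi) - 2/pi^2]. *)
have -> : V2 = 2 / 3 - pi^-1 ^+ 2 - (4^-1 + pi^-1) ^+ 2.
  have : (pi : R) != 0 by rewrite gt_eqF ?pi_gt0.
  by rewrite /V2; move: (pi : R) => q qN0; field.
split; [|exact: quantization_error2|exact: V2_bounds].
move=> A; rewrite /optimal_set_of_means quantization_error2; split.
- by move=> [A2]; case: (distortion_card2 A2).
- move=> ->; split; last exact: distortion_opt.
  by apply/card_le_I2; right; do 2 eexists.
Qed.
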